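(* Let $A\in\mathbb{R}^{n\times n}$ and $b\in\mathbb{R}^n$, and assume that $A-I$ is symmetric positive definite. Then, for any initial vector $x^{(0)}\in\mathbb{R}^n$, the sequence $\{x^{(k)}\}_{k\ge0}$ generated by the monotone block coordinate descent method (Algorithm 2, described in the context) has a limit point which is the solution of the absolute value equation $Ax-|x|=b$.
   Context: For $x\in\mathbb{R}^n$, $|x|=[|x_1|,\dots,|x_n|]^\top$ is the componentwise absolute value, and $\langle x,y\rangle=x^\top y$. $I$ is the identity matrix. Define $f:\mathbb{R}^n\to\mathbb{R}$ by $f(x)=\langle Ax,x\rangle-\langle |x|,x\rangle-2\langle b,x\rangle$. Monotone block coordinate descent method (Algorithm 2). Let $n_1+n_2+\cdots+n_N=n$ with positive integers $n_s$, and partition every $x\in\mathbb{R}^n$ into consecutive blocks $x=[x_{n_1}^\top,x_{n_2}^\top,\dots,x_{n_N}^\top]^\top$, where the $s$-th block $x_{n_s}$ lies in $\mathbb{R}^{n_s}$ (the subscript $n_s$ just labels the $s$-th block). Given $x^{(0)}\in\mathbb{R}^n$, the blocks are updated cyclically: at iteration $k+1$ ($k\ge0$), which produces $x^{(k+1)}$ from $x^{(k)}$, the block index $s\in\{1,\dots,N\}$ is chosen so that $s=r$ at iterations $r,r+N,r+2N,\dots$ for $r=1,\dots,N$ (i.e. $s\equiv k+1 \pmod N$), and $$x_{n_s}^{(k+1)}=\arg\min_{x_{n_s}\in\mathbb{R}^{n_s}} f\bigl(x_{n_1}^{(k)},\dots,x_{n_{s-1}}^{(k)},x_{n_s},x_{n_{s+1}}^{(k)},\dots,x_{n_N}^{(k)}\bigr),\qquad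 x_{n_j}^{(k+1)}=x_{n_j}^{(k)}\ \text{ for all } j\ne s.$$ The sequence is regarded as infinite (no stopping test is applied). A limit point of a sequence is the limit of some convergent subsequence. *)

(* Defs.v *)
From mathcomp Require Import all_boot all_order all_algebra.
From mathcomp Require Import all_classical all_reals topology.
From mathcomp Require Import normedtype sequences.

Set Implicit Arguments.
Unset Strict Implicit.
Unset Printing Implicit Defensive.

Import Order.TTheory GRing.Theory Num.Theory.
Import numFieldNormedType.Exports.

Local Open Scope classical_set_scope.
Local Open Scope ring_scope.

Definition inner (R : realType) (n : nat) (x y : 'cV[R]_n) : R :=
  (x^T *m y) ord0 ord0.

Definition vabs (R : realType) (n : nat) (x : 'cV[R]_n) : 'cV[R]_n :=
  map_mx (fun t : R => `|t|) x.

Definition sym_posdef (R : realType) (n : nat) (M : 'M[R]_n) : Prop :=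
  M^T = M /\ forall x : 'cV[R]_n, x != 0 -> 0 < inner (M *m x) x.

Definition ave_solution (R : realType) (n : nat) (A : 'M[R]_n)
    (b x : 'cV[R]_n) : Prop :=
  A *m x - vabs x = b.

Definition objective (R : realType) (n : nat) (A : 'M[R]_n)
    (b x : 'cV[R]_n) : R :=
  inner (A *m x) x - inner (vabs x) x - 2 * inner b x.

(* A point where g attains its global minimum, and z0 when there is none.
   When A - I is symmetric positive definite, the objective of the method
   restricted to one block is strictly convex and coercive, so that its
   minimizer exists and is unique. *)
Definition argmin (R : realType) (T : choiceType) (z0 : T) (g : T -> R) : T :=
  xget z0 [set z | forall w, g z <= g w].

(* The block sizes are p 0, ..., p (N - 1), so the ambient dimension is
   \sum_(s < N) p s and the s-th block of x is submxcol x s. *)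
Definition replace_block (R : realType) (N : nat) (p : 'I_N -> nat)
    (x : 'cV[R]_(\sum_(s < N) p s)) (s : 'I_N) (z : 'cV[R]_(p s)) :
    'cV[R]_(\sum_(s < N) p s) :=
  \mxcol_(j < N) eqtype.dfwith (submxcol x) z j.

Definition block_update (R : realType) (N : nat) (p : 'I_N -> nat)
    (A : 'M[R]_(\sum_(s < N) p s)) (b : 'cV[R]_(\sum_(s < N) p s))
    (s : 'I_N) (x : 'cV[R]_(\sum_(s < N) p s)) :
    'cV[R]_(\sum_(s < N) p s) :=
  replace_block x
    (argmin (submxcol x s) (fun z => objective A b (replace_block x z))).

(* Blocks are numbered from 0, so x^(k+1) is obtained from x^(k) by updating
   the block of index k mod N. *)
Fixpoint mbcd (R : realType) (N : nat) (N_gt0 : (0 < N)%N) (p : 'I_N -> nat)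
    (A : 'M[R]_(\sum_(s < N) p s)) (b x0 : 'cV[R]_(\sum_(s < N) p s))
    (k : nat) : 'cV[R]_(\sum_(s < N) p s) :=
  if k is k'.+1 then
    block_update A b (Ordinal (ltn_pmod k' N_gt0)) (mbcd N_gt0 A b x0 k')
  else x0.

Definition subseq_limit_point (T : topologicalType) (u : nat -> T) (l : T) : Prop :=
  exists2 phi : nat -> nat, increasing_seq phi & u \o phi @ \oo --> l.

(* Main.v *)
Require Import Defs.
From mathcomp Require Import all_boot all_order all_algebra.
From mathcomp Require Import all_classical all_reals topology.
From mathcomp Require Import normedtype sequences derive ring lra.
Import Order.TTheory GRing.Theory Num.Theory.
Import numFieldNormedType.Exports.
Local Open Scope classical_set_scope.
Local Open Scope ring_scope.

Set Implicit Arguments.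
Unset Strict Implicit.
Unset Printing Implicit Defensive.

(** Write [f] for the objective, [M = A - I] and [r x = A x - |x| - b] for the
    residual, which is half the gradient of [f]. Since
    [f x = <M x, x> + sum_i h (x_i) - 2 <b, x>] with [h t = t ^+ 2 - t * |t|]
    convex, and since [<M x, x> >= c <x, x>] for some [c > 0], the function [f]
    is differentiable and strongly convex:
      [f (x + d) >= f x + 2 <r x, d> + c <d, d>]  ([objective_lower]).
    This inequality drives the proof.

    - It makes [f] coercive, hence [f] attains its minimum on every nonempty
      closed set ([objective_attains_min]), and the partial derivatives vanish
      at a minimum along the free coordinates ([residual_coord_eq0]). On the
      whole space this gives a solution of the absolute value equation; on a
      block it shows that the block minimizer exists and zeroes the residual on
      that block.
    - If [r y = 0] then [c^2 <x - y, x - y> <= <r x, r x>] ([error_bound]). This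
      gives uniqueness of the solution, and reduces convergence of the iterates to
      convergence of their residuals to 0.
    - Taken at the new iterate, it shows that an exact block minimization
      decreases [f] by at least [c] times the squared step
      ([block_update_descent]), so the steps tend to 0 because [f] is bounded
      below.
    - Each coordinate of the residual is zeroed once per sweep of [N] updates
      and moves by vanishing amounts in between, so the residuals tend to 0.

    Hence the whole sequence of iterates converges to the unique solution, which
    is in particular a limit point. *)

(** * The inner product and coercivity of positive definite matrices *)

Section InnerProduct.
Variables (R : realType) (n : nat).
Implicit Types (x y z : 'cV[R]_n) (M : 'M[R]_n) (a : R).

Lemma innerE x y : inner x y = \sum_i x i ord0 * y i ord0.
Proof. by rewrite /inner mxE; apply: eq_bigr => i _; rewrite mxE. Qed.

Lemma innerC x y : inner x y = inner y x.
Proof. by rewrite !innerE; apply: eq_bigr => i _; rewrite mulrC. Qed.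

Lemma innerDr x y z : inner x (y + z) = inner x y + inner x z.
Proof. by rewrite /inner mulmxDr mxE. Qed.

Lemma innerDl x y z : inner (x + y) z = inner x z + inner y z.
Proof. by rewrite innerC innerDr !(innerC z). Qed.

Lemma innerZr a x y : inner x (a *: y) = a * inner x y.
Proof. by rewrite /inner -scalemxAr mxE. Qed.

Lemma innerZl a x y : inner (a *: x) y = a * inner x y.
Proof. by rewrite innerC innerZr innerC. Qed.

Lemma innerNr x y : inner x (- y) = - inner x y.
Proof. by rewrite /inner mulmxN mxE. Qed.

Lemma innerNl x y : inner (- x) y = - inner x y.
Proof. by rewrite innerC innerNr innerC. Qed.

Lemma inner0r x : inner x 0 = 0.
Proof. by rewrite /inner mulmx0 mxE. Qed.

Lemma inner_delta x i : inner x (delta_mx i ord0) = x i ord0.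
Proof.
rewrite innerE (bigD1 i)//= big1 => [|j ji]; rewrite mxE ?eqxx ?(negbTE ji).
  by rewrite mulr1 addr0.
by rewrite mulr0.
Qed.

Lemma inner_sym_mul M x y : M^T = M -> inner (M *m x) y = inner (M *m y) x.
Proof. by move=> MT; rewrite innerC /inner trmx_mul MT mulmxA. Qed.

Lemma inner_ge0 x : 0 <= inner x x.
Proof. by rewrite innerE; apply: sumr_ge0 => i _; rewrite -expr2 sqr_ge0. Qed.

Lemma sqr_coord_le_inner x i : x i ord0 ^+ 2 <= inner x x.
Proof.
rewrite innerE (bigD1 i)//= expr2 lerDl.
by apply: sumr_ge0 => j _; rewrite -expr2 sqr_ge0.
Qed.

Lemma inner_eq0 x : inner x x = 0 -> x = 0.
Proof.
move=> x0; apply/colP => i; rewrite mxE; apply/eqP.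
by rewrite -sqrf_eq0 eq_le sqr_ge0 andbT -x0 sqr_coord_le_inner.
Qed.

(** Young's inequality, from [0 <= <x - a y, x - a y>]. *)
Lemma inner_young a x y : 0 < a ->
  2 * a * inner x y <= inner x x + a ^+ 2 * inner y y.
Proof.
move=> a0; have := inner_ge0 (x - a *: y).
rewrite innerDr !innerDl !innerNr !innerNl !innerZr !innerZl (innerC y x).
by move: (inner x y) (inner x x) (inner y y) => p q r; lra.
Qed.

Lemma posdef_ge0 M x : sym_posdef M -> 0 <= inner (M *m x) x.
Proof.
move=> [_ Mpos]; have [->|/Mpos/ltW//] := eqVneq x 0.
by rewrite inner0r.
Qed.

Lemma posdef_unitmx M : sym_posdef M -> M \in unitmx.
Proof.
move=> [MT Mpos]; rewrite -row_free_unit -kermx_eq0; apply/eqP/row_matrixP => i.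
rewrite row0; apply/eqP; apply: contraT => ker_neq0.
have := Mpos (row i (kermx M))^T; rewrite -trmx0 (inj_eq trmx_inj) => /(_ ker_neq0).
have -> : M *m (row i (kermx M))^T = 0.
  by rewrite -{1}MT -trmx_mul -row_mul mulmx_ker row0 trmx0.
by rewrite innerC inner0r ltxx.
Qed.

(** Cauchy-Schwarz for the inner product defined by [M], from the positivity of
    [<M z, z>] at [z = <M y, y> x - <M x, y> y], a multiple of the component of
    [x] orthogonal to [y]. *)
Lemma posdef_cauchy_schwarz M x y : sym_posdef M ->
  inner (M *m x) y ^+ 2 <= inner (M *m x) x * inner (M *m y) y.
Proof.
move=> Mpd; have [MT Mpos] := Mpd.
have [->|y0] := eqVneq y 0; first by rewrite !inner0r expr0n mulr0.
have yy := Mpos _ y0.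
have := posdef_ge0 (inner (M *m y) y *: x - inner (M *m x) y *: y) Mpd.
rewrite mulmxDr mulmxN -!scalemxAr innerDr !innerDl !innerNr !innerNl.
rewrite !innerZr !innerZl (inner_sym_mul y x MT).
move: yy; move: (inner (M *m x) y) (inner (M *m x) x) (inner (M *m y) y).
move=> p q r r0 H.
have : 0 <= r * (q * r - p ^+ 2) by nra.
by rewrite pmulr_rge0// subr_ge0.
Qed.

(** Applying Cauchy-Schwarz to [x] and [M^-1 e_i] bounds the i-th coordinate
    [<M x, M^-1 e_i>] of [x]; summing over [i] gives the constant
    [1 / tr (M^-1)], with the trace enlarged by 1 so that it is positive
    in dimension 0 as well. *)
Lemma posdef_coercive M : sym_posdef M ->
  exists2 c : R, 0 < c & forall x, c * inner x x <= inner (M *m x) x.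
Proof.
move=> Mpd; have [MT _] := Mpd; have Mu := posdef_unitmx Mpd.
pose v i := invmx M *m (delta_mx i ord0 : 'cV[R]_n).
pose K : R := 1 + \sum_i inner (M *m v i) (v i).
have K0 : 0 < K.
  by rewrite ltr_wpDr// sumr_ge0// => i _; exact: posdef_ge0.
exists K^-1 => [|x]; first by rewrite invr_gt0.
rewrite mulrC ler_pdivrMr// /K mulrDr mulr1 mulr_sumr innerE.
apply: ler_wpDl; first exact: posdef_ge0.
apply: ler_sum => i _; rewrite -expr2.
have -> : x i ord0 = inner (M *m x) (v i).
  by rewrite (inner_sym_mul _ _ MT) /v mulmxA mulmxV// mul1mx innerC inner_delta.
exact: posdef_cauchy_schwarz.
Qed.

Lemma posdef_sub1_sym M : sym_posdef (M - 1%:M) -> M^T = M.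
Proof. by case=> + _; rewrite linearB/= trmx1 => /addIr. Qed.

End InnerProduct.

(** * The objective as a strongly convex function *)

Lemma quadratic_ge0_linear_eq0 (R : realType) (g k : R) :
  (forall t, 0 <= 2 * t * g + t ^+ 2 * k) -> g = 0.
Proof.
move=> quad_ge0.
have [m m0 km] : exists2 m : R, 0 < m & k <= m.
  by exists (`|k| + 1); rewrite ?ltr_wpDl// (le_trans (ler_norm k))// lerDl.
(* The point tested is the minimizer of the polynomial with k replaced by m. *)
have := quad_ge0 (- g / m).
have -> : 2 * (- g / m) * g + (- g / m) ^+ 2 * k = (g / m) ^+ 2 * (k - 2 * m).
  by field; rewrite gt_eqF.
rewrite nmulr_lge0; last by lra.
move=> gm_le0; have : (g / m) ^+ 2 == 0 by rewrite eq_le gm_le0 sqr_ge0.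
by rewrite sqrf_eq0 mulf_eq0 invr_eq0 (gt_eqF m0) orbF => /eqP.
Qed.

Section Objective.
Variables (R : realType) (n : nat) (A : 'M[R]_n) (b : 'cV[R]_n).
Implicit Types (x y d : 'cV[R]_n).

(** Half the gradient of the objective at [x], for symmetric [A]. *)
Definition residual x := A *m x - vabs x - b.

Lemma ave_solutionP x : ave_solution A b x <-> residual x = 0.
Proof.
split=> [xE|/subr0_eq//].
by move: xE; rewrite /ave_solution /residual => ->; rewrite subrr.
Qed.

(** The remainder of the first-order expansion of the objective at [x] is
    [<(A - I) d, d>] plus a sum over the coordinates of the remainders of the
    convex function [h t = t ^+ 2 - t * `|t|], which vanishes on [t >= 0] and is
    [2 t ^+ 2] on [t <= 0]. *)
Lemma objective_expansion x d : A^T = A ->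
  objective A b (x + d) =
  objective A b x + 2 * inner (residual x) d + inner ((A - 1%:M) *m d) d
  + \sum_i (d i ord0 ^+ 2 - `|x i ord0 + d i ord0| * (x i ord0 + d i ord0)
            + `|x i ord0| * (x i ord0 + 2 * d i ord0)).
Proof.
move=> AT; rewrite /objective /residual mulmxDr mulmxBl mul1mx.
rewrite !(innerDl, innerDr, innerNl) (inner_sym_mul d x AT).
have -> : \sum_i (d i ord0 ^+ 2 - `|x i ord0 + d i ord0| * (x i ord0 + d i ord0)
    + `|x i ord0| * (x i ord0 + 2 * d i ord0)) =
    inner d d - inner (vabs (x + d)) (x + d) + inner (vabs x) x
    + 2 * inner (vabs x) d.
  rewrite !innerE mulr_sumr -sumrB -!big_split/=; apply: eq_bigr => i _.
  by rewrite !mxE; ring.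
rewrite innerDr; ring.
Qed.

Lemma objective_lower x d : A^T = A ->
  objective A b x + 2 * inner (residual x) d + inner ((A - 1%:M) *m d) d
  <= objective A b (x + d).
Proof.
move=> AT; rewrite objective_expansion// lerDl; apply: sumr_ge0 => i _.
move: (x i ord0) (d i ord0) => t u.
by have [|] := ger0P t; have [|] := ger0P (t + u); nra.
Qed.

Lemma objective_upper x d : A^T = A ->
  objective A b (x + d) <=
  objective A b x + 2 * inner (residual x) d + inner ((A - 1%:M) *m d) d
  + 2 * inner d d.
Proof.
move=> AT; rewrite objective_expansion// lerD2l innerE mulr_sumr.
apply: ler_sum => i _; move: (x i ord0) (d i ord0) => t u.
by have [|] := ger0P t; have [|] := ger0P (t + u); nra.
Qed.

(** The upper bound turns minimality along a coordinate line into
    [0 <= 2 t g + t ^+ 2 K] for all [t], with [g] the coordinate of the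
    residual. *)
Lemma residual_coord_eq0 x i : A^T = A ->
  (forall t, objective A b x <= objective A b (x + t *: delta_mx i ord0)) ->
  residual x i ord0 = 0.
Proof.
move=> AT xmin; pose e : 'cV[R]_n := delta_mx i ord0.
pose K := inner ((A - 1%:M) *m e) e + 2 * inner e e.
have quad_ge0 t : 0 <= 2 * t * residual x i ord0 + t ^+ 2 * K.
  have := le_trans (xmin t) (objective_upper x (t *: e) AT).
  rewrite -scalemxAr !(innerZr, innerZl) /e inner_delta -/e /K.
  move: (objective _ _ _) (residual _ _ _) (inner _ _) (inner _ _) => p q r s.
  lra.
exact: quadratic_ge0_linear_eq0 quad_ge0.
Qed.

Section Coercive.
Variable c : R.
Hypotheses (AT : A^T = A) (c0 : 0 < c).
Hypothesis coer : forall d, c * inner d d <= inner ((A - 1%:M) *m d) d.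

(** Adding the lower bounds taken at [x] and at [y] gives the strong
    monotonicity estimate [c <x - y, x - y> <= <residual x, x - y>]; Young's
    inequality then absorbs [x - y]. *)
Lemma error_bound x y : residual y = 0 ->
  c ^+ 2 * inner (x - y) (x - y) <= inner (residual x) (residual x).
Proof.
move=> ry0; have xE : y + (x - y) = x by rewrite addrC subrK.
have yE : x - (x - y) = y by rewrite subKr.
move: (x - y) xE yE => d xE yE.
have := objective_lower y d AT; rewrite xE ry0 (innerC 0) inner0r mulr0 addr0.
have := objective_lower x (- d) AT; rewrite yE.
rewrite mulmxN !(innerNr, innerNl) opprK.
move=> Hx Hy; have young := inner_young (residual x) d c0.
have : c * inner d d <= inner (residual x) d by have := coer d; lra.
by rewrite -(ler_pM2l c0); lra.
Qed.

Lemma ave_solution_unique x y :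
  ave_solution A b x -> ave_solution A b y -> x = y.
Proof.
move=> /ave_solutionP rx /ave_solutionP ry; have := error_bound x ry.
rewrite rx inner0r pmulr_rle0 ?exprn_gt0// => xy0.
by apply/subr0_eq/inner_eq0/eqP; rewrite eq_le xy0 inner_ge0.
Qed.

(** The lower bound at the origin, with the linear term absorbed by Young's
    inequality. *)
Lemma objective_coercive x :
  c ^+ 2 * inner x x - 4 * inner b b <= 2 * c * objective A b x.
Proof.
have := objective_lower 0 x AT.
have v0 : vabs (0 : 'cV[R]_n) = 0.
  by apply/colP => i; rewrite !mxE normr0.
rewrite /residual mulmx0 v0 subrr !sub0r add0r innerNl.
have -> : objective A b 0 = 0 by rewrite /objective !inner0r mulr0 !subr0.
move=> lower; have := inner_young (2 *: b) x c0; rewrite !(innerZl, innerZr).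
have : c * inner x x - 2 * inner b x <= objective A b x.
  by have := coer x; lra.
by rewrite -(ler_pM2l c0); lra.
Qed.

End Coercive.
End Objective.

(** * Existence of minimizers *)

Lemma cvg_mx_coord (R : realType) (m n : nat) (T : Type) (F : set_system T)
    {FF : Filter F} (u : T -> 'M[R]_(m, n)) (l : 'M[R]_(m, n)) :
  (forall i j, u t i j @[t --> F] --> l i j) -> u t @[t --> F] --> l.
Proof.
move=> ucvg; apply/cvg_ballP => e e0.
have near_ball i j : \forall t \near F, ball (l i j) e (u t i j).
  by move/cvg_ballP: (ucvg i j); apply.
have := filter_forall FF (fun i => filter_forall FF (near_ball i)).
by apply: filterS => t ut; split.
Qed.

Lemma compact_col_box (R : realType) (n : nat) (K : R) :
  compact [set x : 'cV[R]_n | forall i, `[- K, K]%classic (x i ord0)].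
Proof.
have box_compact := @rV_compact R n _ (fun=> @segment_compact R (- K) K).
have trmx_cont : {within [set v : 'rV[R]_n | forall i,
    `[- K, K]%classic (v ord0 i)], continuous (fun v : 'rV[R]_n => v^T)}.
  apply: continuous_subspaceT => v; apply: (cvg_mx_coord (F := nbhs v)) => i j.
  rewrite mxE; under eq_fun do rewrite mxE; exact: coord_continuous.
apply: subclosed_compact (continuous_compact trmx_cont box_compact) _.
  have -> : [set x : 'cV[R]_n | forall i, `[- K, K]%classic (x i ord0)] =
      \bigcap_i ((fun x : 'cV[R]_n => x i ord0) @^-1` `[- K, K]%classic).
    by apply/seteqP; split=> x /= xK i; [move=> _; exact: xK|exact: (xK i I)].
  apply: closed_bigI => i _; apply: preimage_closed; last exact: interval_closed.
  by move=> x _; exact: coord_continuous.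
by move=> x xK; exists x^T; rewrite ?trmxK// => i; rewrite mxE.
Qed.

Section Minimizers.
Variables (R : realType) (n : nat) (A : 'M[R]_n) (b : 'cV[R]_n).
Implicit Types (x y : 'cV[R]_n).

Lemma objective_continuous : continuous (objective A b).
Proof.
have -> : objective A b = fun x => \sum_i ((\sum_j A i j * x j ord0) * x i ord0
    - `|x i ord0| * x i ord0 - 2 * (b i ord0 * x i ord0)).
  apply/funext => x; rewrite /objective !innerE mulr_sumr -!sumrB.
  by apply: eq_bigr => i _; rewrite !mxE.
have coord i : continuous (fun x : 'cV[R]_n => x i ord0).
  exact: coord_continuous.
have sum_cont (F : 'I_n -> 'cV[R]_n -> R) :
    (forall i, continuous (F i)) -> continuous (fun x => \sum_i F i x).
  move=> Fcont; apply: (continuous_big (@add_continuous R)) => i _.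
  exact: Fcont.
have sub_cont (f g : 'cV[R]_n -> R) :
    continuous f -> continuous g -> continuous (fun x => f x - g x).
  by move=> fc gc x; exact: (@continuousB R R _ f g x (fc x) (gc x)).
have mul_cont (f g : 'cV[R]_n -> R) :
    continuous f -> continuous g -> continuous (fun x => f x * g x).
  by move=> fc gc x; exact: (continuousM (fc x) (gc x)).
have cst_cont (k : R) : continuous (fun _ : 'cV[R]_n => k).
  exact: cst_continuous.
apply: (sum_cont) => i; apply: (sub_cont); first apply: (sub_cont).
- by apply: (mul_cont) => //; apply: (sum_cont) => j; exact: mul_cont.
- apply: (mul_cont) => // x.
  by apply: (continuous_comp (coord i x)); exact: norm_continuous.
- by do 2 apply: (mul_cont) => //.
Qed.

(** By coercivity the sublevel set of any point of [C] lies in a compact box, and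
    a minimizer over this part of [C] is a minimizer over [C]. *)
Lemma objective_attains_min (C : set 'cV[R]_n) :
  sym_posdef (A - 1%:M) -> closed C -> C !=set0 ->
  exists2 y, C y & forall w, C w -> objective A b y <= objective A b w.
Proof.
move=> Apd Cclosed [x0 Cx0].
have AT := posdef_sub1_sym Apd.
have [c c0 coer] := posdef_coercive Apd.
pose S := C `&` [set y | objective A b y <= objective A b x0].
pose K0 := (2 * c * objective A b x0 + 4 * inner b b) / c ^+ 2.
have SK y : S y -> inner y y <= K0.
  move=> [_ /= fy]; rewrite /K0 ler_pdivlMr ?exprn_gt0// mulrC.
  have := objective_coercive b AT c0 coer y.
  rewrite -(ler_pM2l c0) in fy; lra.
have Sx0 : S x0 by split=> /=.
have K0_ge0 : 0 <= K0 := le_trans (inner_ge0 x0) (SK _ Sx0).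
have Scompact : compact S.
  apply: subclosed_compact (@compact_col_box R n (K0 + 1)) _.
    apply: closedI => //; pose le_fx0 := [set t : R | t <= objective A b x0].
    apply: (@preimage_closed _ _ (objective A b) le_fx0); last exact: closed_le.
    by move=> y _; exact: objective_continuous.
  move=> y /SK yK i /=; rewrite in_itv/=; have := sqr_coord_le_inner y i.
  by move: (y i ord0) => t; nra.
have fcont : {within S, continuous (objective A b)}.
  exact: continuous_subspaceT objective_continuous.
have [y] := compact_EVT_min (ex_intro _ x0 Sx0) Scompact fcont.
rewrite inE => -[Cy fy] ymin; exists y => // w Cw.
have [fw|/ltW fw] := lerP (objective A b w) (objective A b x0).
  by apply: ymin; rewrite inE.
exact: le_trans fw.
Qed.

End Minimizers.

(** * Null sequences *)

Lemma cvg0_sum (R : realType) (I : finType) (u : I -> nat -> R) :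
  (forall i, u i k @[k --> \oo] --> 0) -> (\sum_i u i k) @[k --> \oo] --> 0.
Proof.
move=> u0; have := @cvg_big R I +%R 0 xpredT (@add_continuous R) _ _
  (index_enum I) u (fun=> 0) eventually_filter (fun i _ => u0 i).
by rewrite [X in _ --> X -> _]big1.
Qed.

Lemma cvg0_sqr (R : realType) (u : nat -> R) :
  u k ^+ 2 @[k --> \oo] --> 0 -> u k @[k --> \oo] --> 0.
Proof.
move=> /cvgr0Pnorm_lt u0; apply/cvgr0Pnorm_lt => e e0.
have := u0 (e ^+ 2) (exprn_gt0 2 e0); apply: filterS => k.
by rewrite normrX ltr_pXn2r ?nnegrE ?normr_ge0// ltW.
Qed.

Lemma cvg0_le (R : realType) (u v : nat -> R) :
  (forall k, 0 <= u k <= v k) -> v k @[k --> \oo] --> 0 ->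
  u k @[k --> \oo] --> 0.
Proof.
move=> uv v0; apply: (@squeeze_cvgr _ _ _ _ (fun=> 0) v u) => //.
  by near=> k; exact: uv.
exact: cvg_cst.
Unshelve. all: by end_near. Qed.

Lemma cvg0_decrements (R : realType) (f : nat -> R) (m : R) :
  (forall k, f k.+1 <= f k) -> (forall k, m <= f k) ->
  (f k - f k.+1) @[k --> \oo] --> 0.
Proof.
move=> fS fm; have fcvg : cvgn f.
  apply: nonincreasing_is_cvgn; last by exists m => _ [k _ <-].
  by apply/nonincreasing_seqP.
rewrite -(subrr (limn f)); apply: cvgB => //.
by rewrite (cvg_shiftS f).
Qed.

(** At any time, at most [N] increments separate the sequence from one of its
    zeros, and a bounded number of vanishing increments has a vanishing sum. *)
Lemma cvg0_recurrent_zero (R : realType) (N : nat) (w : nat -> R) :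
  (w k.+1 - w k) @[k --> \oo] --> 0 ->
  (forall k, exists2 j, (j <= N)%N & w (k + j)%N = 0) ->
  w k @[k --> \oo] --> 0.
Proof.
move=> dw w0; apply/cvgr0Pnorm_lt => e e0.
have e'0 : 0 < e / N.+1%:R by rewrite divr_gt0.
have [K _ dwK] := (cvgr0Pnorm_lt _).1 dw _ e'0.
exists K => // k /= Kk; have [j jN wj] := w0 k.
have dist_le i : `|w (k + i)%N - w k| <= i%:R * (e / N.+1%:R).
  elim: i => [|i IH]; first by rewrite addn0 subrr normr0 mul0r.
  rewrite addnS -natr1 mulrDl mul1r [leRHS]addrC.
  apply: le_trans (ler_distD (w (k + i)%N) _ _) _.
  apply: lerD => //; apply/ltW/dwK => /=.
  exact: leq_trans Kk (leq_addr _ _).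
have := dist_le j; rewrite wj sub0r normrN => /le_lt_trans; apply.
by rewrite mulrCA gtr_pMr// ltr_pdivrMr// mul1r ltr_nat ltnS.
Qed.

(** * One block update *)

Section BlockUpdate.
Variables (R : realType) (N : nat) (p : 'I_N -> nat).
Local Notation n := (\sum_(s < N) p s)%N.
Implicit Types (x y w : 'cV[R]_n) (s : 'I_N).

Lemma replace_block_out x s (z : 'cV[R]_(p s)) i : tagnat.sig1 i != s ->
  replace_block x z i ord0 = x i ord0.
Proof.
by move=> si; rewrite mxE dfwith_out 1?eq_sym// mxE tagnat.sig2K.
Qed.

Lemma replace_block_submxcol x y s :
  (forall i, tagnat.sig1 i != s -> y i ord0 = x i ord0) ->
  replace_block x (submxcol y s) = y.
Proof.
move=> yx; apply/mxcolP => j; rewrite mxcolK.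
have [<-|sj] := eqVneq s j; first by rewrite dfwith_in.
rewrite dfwith_out//; apply/matrixP => k l; rewrite (ord1 l) !mxE yx//.
by rewrite tagnat.Rank1K eq_sym.
Qed.

Variables (A : 'M[R]_n) (b : 'cV[R]_n).
Hypothesis Apd : sym_posdef (A - 1%:M).

Lemma block_update_out x s i : tagnat.sig1 i != s ->
  block_update A b s x i ord0 = x i ord0.
Proof. exact: replace_block_out. Qed.

(** Minimizing over the block [s] is minimizing over the closed affine subspace
    of the vectors that agree with [x] off this block; existence of a minimizer
    there rules out the default value of [argmin]. *)
Lemma block_update_min x s w :
  (forall i, tagnat.sig1 i != s -> w i ord0 = x i ord0) ->
  objective A b (block_update A b s x) <= objective A b w.
Proof.
move=> wx; pose C := [set y : 'cV[R]_n |
  forall i, tagnat.sig1 i != s -> y i ord0 = x i ord0].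
have Cclosed : closed C.
  have -> : C = \bigcap_(i in [set i | tagnat.sig1 i != s])
      ((fun y : 'cV[R]_n => y i ord0) @^-1` [set x i ord0]).
    by apply/seteqP; split.
  apply: closed_bigI => i _; apply: preimage_closed; last exact: closed_eq.
  by move=> y _; exact: coord_continuous.
have [|y Cy ymin] := objective_attains_min b Apd Cclosed; first by exists x.
rewrite -(replace_block_submxcol wx).
have min_ex : exists z : 'cV[R]_(p s), forall z' : 'cV[R]_(p s),
    objective A b (replace_block x z) <= objective A b (replace_block x z').
  exists (submxcol y s) => z; rewrite replace_block_submxcol//.
  by apply: ymin => i si; rewrite replace_block_out.
exact: (xgetPex (submxcol x s) min_ex (submxcol w s)).
Qed.

Lemma block_update_residual x s i : tagnat.sig1 i = s ->
  residual A b (block_update A b s x) i ord0 = 0.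
Proof.
move=> si; apply: residual_coord_eq0 => [|t]; first exact: posdef_sub1_sym.
apply: block_update_min => j js; rewrite -(block_update_out x js).
move: (block_update A b s x) => y; rewrite !mxE.
have /negbTE -> : j != i by apply: contraNneq js => ->; rewrite si.
by rewrite mulr0 addr0.
Qed.

(** The step is supported on block [s], where the residual of the new point
    vanishes, so that the first-order term of the lower bound disappears. *)
Lemma block_update_descent c x y s :
  (forall d, c * inner d d <= inner ((A - 1%:M) *m d) d) ->
  y = block_update A b s x ->
  objective A b y + c * inner (x - y) (x - y) <= objective A b x.
Proof.
move=> coer yE.
have := objective_lower b y (x - y) (posdef_sub1_sym Apd).
rewrite [y + _]addrC subrK; apply: le_trans.
have -> : inner (residual A b y) (x - y) = 0.
  rewrite innerE big1// => i _; have [si|si] := eqVneq (tagnat.sig1 i) s.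
    by rewrite {1}yE block_update_residual ?mul0r.
  have yx : y i ord0 = x i ord0 by rewrite yE block_update_out.
  by rewrite !mxE yx subrr mulr0.
by rewrite mulr0 addr0 lerD2l.
Qed.

End BlockUpdate.

(** * Convergence of the cyclic method *)

Section Convergence.
Variables (R : realType) (N : nat) (N_gt0 : (0 < N)%N) (p : 'I_N -> nat).
Local Notation n := (\sum_(s < N) p s)%N.
Variables (A : 'M[R]_n) (b x0 : 'cV[R]_n).
Hypothesis Apd : sym_posdef (A - 1%:M).
Local Notation u := (mbcd N_gt0 A b x0).

(** By the descent inequality, the squared steps are controlled by the
    decrements of the objective along the iterates, and these tend to 0 because
    the objective is bounded below. *)
Lemma mbcd_step_cvg0 i : (u k.+1 i ord0 - u k i ord0) @[k --> \oo] --> 0.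
Proof.
have [c c0 coer] := posdef_coercive Apd; have AT := posdef_sub1_sym Apd.
pose f k := objective A b (u k).
have descent k : f k.+1 + c * inner (u k - u k.+1) (u k - u k.+1) <= f k.
  exact: (block_update_descent Apd coer (x := u k) erefl).
have f_cvg0 : (f k - f k.+1) @[k --> \oo] --> 0.
  apply: (@cvg0_decrements _ _ (- 2 * inner b b / c)) => k.
    apply: le_trans (descent k); rewrite lerDl mulr_ge0 ?inner_ge0//.
    exact: ltW.
  rewrite ler_pdivrMr//; have := objective_coercive b AT c0 coer (u k).
  have := mulr_ge0 (ltW (exprn_gt0 2 c0)) (inner_ge0 (u k)).
  rewrite -/(f k); lra.
apply: cvg0_sqr; apply: (@cvg0_le _ _ (fun k => c^-1 * (f k - f k.+1))).
  move=> k; rewrite sqr_ge0/= mulrC ler_pdivlMr// mulrC lerBrDl.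
  apply: le_trans (descent k); rewrite lerD2l ler_pM2l//.
  apply: le_trans (sqr_coord_le_inner _ i).
  by rewrite -sqrrN opprB !mxE.
by rewrite -(mulr0 c^-1); apply: cvgM => //; exact: cvg_cst.
Qed.

Lemma mbcd_residual_eq0 k i : exists2 j, (j <= N)%N &
  residual A b (u (k + j)%N) i ord0 = 0.
Proof.
pose s := tagnat.sig1 i; pose j := ((s + (N - k %% N)) %% N)%N.
(* The update numbered k + j is the next one, from k on, to treat block s; its
   result is the iterate k + j + 1. *)
exists j.+1; first by rewrite ltn_mod.
rewrite addnS /=; apply: block_update_residual => //; apply: val_inj => /=.
rewrite /j modnDmr -modnDml addnCA subnKC; last by rewrite ltnW// ltn_mod.
by rewrite modnDr modn_small.
Qed.

(** Consecutive residuals differ by a null sequence, since the residual is a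
    sum of Lipschitz functions of the coordinates, and each coordinate of the
    residual is reset to 0 once per sweep. *)
Lemma mbcd_residual_cvg0 i : residual A b (u k) i ord0 @[k --> \oo] --> 0.
Proof.
apply: (@cvg0_recurrent_zero _ N); last by move=> k; exact: mbcd_residual_eq0.
have -> : (fun k => residual A b (u k.+1) i ord0 - residual A b (u k) i ord0) =
    (fun k => \sum_j A i j * (u k.+1 j ord0 - u k j ord0)
      - (`|u k.+1 i ord0| - `|u k i ord0|)).
  apply/funext => k; move: (u k.+1) (u k) => y x; rewrite !mxE.
  under [in RHS]eq_bigr do rewrite mulrBr.
  by rewrite sumrB; ring.
have linear_cvg0 :
    (\sum_j A i j * (u k.+1 j ord0 - u k j ord0)) @[k --> \oo] --> 0.
  apply: cvg0_sum => j; rewrite -(mulr0 (A i j)).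
  by apply: cvgM; [exact: cvg_cst|exact: mbcd_step_cvg0].
have vabs_cvg0 : (`|u k.+1 i ord0| - `|u k i ord0|) @[k --> \oo] --> 0.
  apply/norm_cvg0P; apply: cvg0_le; last exact/norm_cvg0P/(mbcd_step_cvg0 i).
  by move=> k /=; rewrite normr_ge0 ler_dist_dist.
by have := cvgB linear_cvg0 vabs_cvg0; rewrite subr0; exact.
Qed.

(** The error bound turns null residuals into convergence. *)
Lemma mbcd_cvg y : ave_solution A b y -> u k @[k --> \oo] --> y.
Proof.
move=> /ave_solutionP ry0; apply: cvg_mx_coord => i o; rewrite (ord1 o).
have [c c0 coer] := posdef_coercive Apd; have AT := posdef_sub1_sym Apd.
apply/subr_cvg0; apply: cvg0_sqr.
apply: (@cvg0_le _ _ (fun k => (c ^+ 2)^-1 *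
    \sum_j (residual A b (u k) j ord0 * residual A b (u k) j ord0))).
  move=> k; rewrite sqr_ge0/= mulrC ler_pdivlMr ?exprn_gt0// -innerE.
  apply: le_trans (error_bound AT c0 coer (u k) ry0).
  rewrite mulrC ler_pM2l ?exprn_gt0//.
  by apply: le_trans (sqr_coord_le_inner _ i); rewrite !mxE.
have res_cvg0 : (\sum_j (residual A b (u k) j ord0 * residual A b (u k) j ord0))
    @[k --> \oo] --> 0.
  apply: cvg0_sum => j; rewrite -(mulr0 0).
  by apply: cvgM; exact: mbcd_residual_cvg0.
by have := cvgM (cvg_cst (c ^+ 2)^-1) res_cvg0; rewrite mulr0; exact.
Qed.

End Convergence.

(** A global minimizer of the objective is a critical point. *)
Lemma ave_solution_exists (R : realType) (n : nat) (A : 'M[R]_n) (b : 'cV[R]_n) :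
  sym_posdef (A - 1%:M) -> exists x, ave_solution A b x.
Proof.
move=> Apd.
have [|x _ xmin] := objective_attains_min b Apd closedT; first by exists 0.
exists x; apply/ave_solutionP/colP => i; rewrite [RHS]mxE.
apply: residual_coord_eq0 => [|t]; last exact: xmin.
exact: posdef_sub1_sym.
Qed.

Theorem theorem3p1 (R : realType) (N : nat) (N_gt0 : (0 < N)%N)
    (p : 'I_N -> nat) (p_gt0 : forall s : 'I_N, (0 < p s)%N)
    (A : 'M[R]_(\sum_(s < N) p s)) (b : 'cV[R]_(\sum_(s < N) p s))
    (hA : sym_posdef (A - 1%:M)) :
  forall x0 : 'cV[R]_(\sum_(s < N) p s),
  exists xstar : 'cV[R]_(\sum_(s < N) p s),
    subseq_limit_point (mbcd N_gt0 A b x0) xstar /\ unique (ave_solution A b) xstar.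
Proof.
move=> x0; have [y y_sol] := ave_solution_exists b hA.
exists y; split; first by exists id => //; exact: mbcd_cvg.
split=> // z z_sol; have [c c0 coer] := posdef_coercive hA.
exact: ave_solution_unique (posdef_sub1_sym hA) c0 coer _ _ y_sol z_sol.
Qed.
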